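(* Let $X$ be a Tychonoff space with a distinguished point $e\in X$. The free Boolean topological group $B(X)$ on $X$ is Weil complete if and only if $X$ is Dieudonné complete.
   Context: All topological groups are assumed Hausdorff and all spaces Tychonoff (including Hausdorff). A Boolean group is a group in which every non-neutral element has order 2; such groups are Abelian and are written additively. Free Boolean topological group (in the sense of Graev): for a Tychonoff space $X$ with a distinguished point $e\in X$, $B(X)$ is the topological group determined by: (i) $B(X)$ is a topological Boolean group, $X$ is a subspace of $B(X)$, and $B(X)$ is generated by $X$; (ii) every continuous map $f\colon X\to H$ to a Boolean topological group $H$ with $f(e)=e_H$ (the neutral element of $H$) extends to a continuous homomorphism $\widehat f\colon B(X)\to H$. As an abstract group, $B(X)$ is the Boolean group (vector space over $\mathbb F_2$) with basis $X\setminus\{e\}$ and with zero element identified with $e$. Up to topological isomorphism $B(X)$ does not depend on the choice of $e$. Weil completeness: a topological group $G$ is Weil complete if it is complete with respect to its left uniformity, which has base $\{\{(g,h)\in G\times G: h\in gV\}: V \text{ a neighborhood of the identity}\}$; that is, every Cauchy filter for this uniformity converges. For Abelian $G$ this coincides with completeness in the two-sided uniformity (Raĭkov completeness). Dieudonné completeness: a space $X$ is Dieudonné complete if there is a complete uniformity on $X$ inducing the topology of $X$ (equivalently, the universal, i.e. finest compatible, uniformity of $X$ is complete). *)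

(* Defs.v *)
From HB Require Import structures.
From mathcomp Require Import all_boot all_order all_algebra.
From mathcomp Require Import all_classical all_reals all_analysis.

Set Implicit Arguments.
Unset Strict Implicit.
Unset Printing Implicit Defensive.

Import GRing.Theory.

Local Open Scope classical_set_scope.
Local Open Scope ring_scope.

Definition tychonoff_space (X : topologicalType) : Prop :=
  hausdorff_space X /\ completely_regular_space X.

(* An inhabitant of [Nbhs_isUniform_mixin X] is exactly a uniformity on X that
   induces the given topology of X (field [nbhsE_subproof]). *)
Definition uniformity_space (X : topologicalType)
    (u : Nbhs_isUniform_mixin X) : uniformType :=
  HB.pack_for uniformType (Topological.sort X) u.

(* The library's [completeType] and [cvg] require a pointed carrier; this is the
   same property without that restriction. *)
Definition uniformly_complete (U : uniformType) : Prop :=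
  forall F : set_system U, ProperFilter F -> cauchy F -> exists x : U, F --> x.

Definition dieudonne_complete (X : topologicalType) : Prop :=
  exists u : Nbhs_isUniform_mixin X, uniformly_complete (uniformity_space u).

Section LeftUniformity.
Variable G : topologicalZmodType.

Definition left_translates (V : set G) : set (G * G) :=
  [set gh | exists2 v, V v & gh.2 = gh.1 + v].

Definition left_entourage : set_system (G * G) :=
  filter_from (nbhs (0 : G)) left_translates.

Lemma left_entourage_filter : Filter left_entourage.
Proof.
apply: filter_from_filter; first by exists setT; exact: filterT.
move=> A B nA nB; exists (A `&` B); first exact: filterI.
by move=> gh [v [Av Bv] ghv]; split; exists v.
Qed.

Lemma left_entourage_diagonal (A : set (G * G)) :
  left_entourage A -> (diagonal `<=` A)%classic.
Proof.
move=> [V nV VA] [g h] /= /eqP; rewrite /diagonal => gh; apply: VA.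
by exists 0; [exact: nbhs_singleton | rewrite /= addr0; symmetry; apply/eqP].
Qed.

Lemma left_entourage_inv (A : set (G * G)) :
  left_entourage A -> left_entourage (A^-1)%relation.
Proof.
move=> [V nV VA]; exists (-%R @^-1` V).
  by apply: (@opp_continuous G 0); rewrite oppr0.
move=> [g h] [v Vv /= hgv]; apply: VA; exists (- v) => //=.
by rewrite hgv addrK.
Qed.

Lemma left_entourage_split_ex (A : set (G * G)) : left_entourage A ->
  exists2 B, left_entourage B & (B \; B `<=` A)%relation.
Proof.
move=> [V nV VA].
have [[P Q] [/= nP nQ] PQV] : nbhs ((0, 0) : G * G) [set x | V (x.1 + x.2)].
  by apply: (@add_continuous G (0, 0)); rewrite /= addr0.
exists (left_translates (P `&` Q)).
  by exists (P `&` Q) => //; exact: filterI.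
move=> [g h] [k [v [Pv _] /= kgv] [w [_ Qw] /= hkw]]; apply: VA.
by exists (v + w); [exact: (PQV (v, w)) | rewrite /= hkw kgv addrA].
Qed.

Lemma left_entourage_nbhsE : nbhs = nbhs_ left_entourage.
Proof.
apply/funext => g; apply/seteqP; split=> A.
- move=> nA; have nV : nbhs (0 : G) [set v | A (g + v)].
    have cg : {for 0, continuous (fun v : G => g + v)}.
      apply: (@continuous_comp _ _ _ (fun v : G => (g, v))
                (fun x : G * G => x.1 + x.2)); last exact: add_continuous.
      by apply: cvg_pair; [exact: cvg_cst | exact: cvg_id].
    by apply: cg; rewrite addr0.
  exists (left_translates [set v | A (g + v)]); first by exists [set v | A (g + v)].
  by move=> h /xsectionP[v Av /= ->].
- move=> [E [V nV VE] EA].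
  have cg : {for g, continuous (fun h : G => h - g)}.
    apply: (@continuous_comp _ _ _ (fun h : G => (h, g))
              (fun x : G * G => x.1 - x.2)); last exact: sub_continuous.
    by apply: cvg_pair; [exact: cvg_id | exact: cvg_cst].
  have nV' : nbhs (g - g) V by rewrite subrr.
  have := cg _ nV'; apply: (@filterS G (nbhs g)) => h Vh.
  by apply/EA/xsectionP/VE; exists (h - g) => //=; rewrite addrC subrK.
Qed.

Definition left_uniformity : Nbhs_isUniform_mixin G :=
  Nbhs_isUniform_mixin.Build G left_entourage_filter left_entourage_diagonal
    left_entourage_inv left_entourage_split_ex left_entourage_nbhsE.

End LeftUniformity.

Definition weil_complete (G : topologicalZmodType) : Prop :=
  uniformly_complete (uniformity_space (left_uniformity G)).

(* [topologicalZmodType] does not include separation. *)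
Definition boolean_topological_group (G : topologicalZmodType) : Prop :=
  hausdorff_space G /\ (forall g : G, g != 0 -> g + g = 0).

Definition topological_embedding (X Y : topologicalType) (i : X -> Y) : Prop :=
  injective i /\
  (forall U : set X, open U <-> exists2 V : set Y, open V & i @^-1` V = U).

Definition group_generated_by (G : zmodType) (A : set G) : Prop :=
  forall S : {pred G}, zmod_closed S -> (forall a, A a -> a \in S) ->
  forall g, g \in S.

(* (B, i) is the Graev free Boolean topological group on (X, e): [i] plays the
   role of the inclusion of X in B, under which e is the zero of B.  These
   conditions determine (B, i) up to topological isomorphism. *)
Record free_boolean_topological_group (X : topologicalType) (e : X)
    (B : topologicalZmodType) (i : X -> B) : Prop := {
  free_boolean_group : boolean_topological_group B ;
  free_boolean_embedding : topological_embedding i ;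
  free_boolean_base_point : i e = 0 ;
  free_boolean_generated : group_generated_by (range i) ;
  free_boolean_universal :
    forall (H : topologicalZmodType) (f : X -> H),
      boolean_topological_group H -> continuous f -> f e = 0 ->
      exists2 fhat : {additive B -> H},
        continuous fhat & forall x, fhat (i x) = f x
}.

(* Main.v *)
Require Import Defs.
From HB Require Import structures.
From mathcomp Require Import all_boot all_order all_algebra.
From mathcomp Require Import all_classical all_reals all_analysis.

(* For a uniformity on X compatible with its topology and a sequence E of
   entourages, let V(E) be the set of sums of x_k + y_k, k < n, with (x_k, y_k)
   in E_k.  These sets form a base at 0 of a Hausdorff Boolean group topology, so
   by the universal property each V(E) is a neighbourhood of 0 in B(X); if the
   entourages include the traces of those of B(X), the sets V(E) form a base at 0
   in B(X).  Combinatorially, a word of even length with sum in V(E) has an even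
   number of letters in suitable small clusters, the connected components of the
   graph with edges (x_k, y_k).

   If B(X) is complete, a Cauchy filter on X converges in B(X) to some b; writing
   b as a reduced word of odd length, every letter must be close to the points of
   the filter, so there is only one letter and b lies in X.

   If X is complete and F is a Cauchy filter on B(X), a diagonal choice of E shows
   that F stays close to the words of some fixed length n.  Lift F to an
   ultrafilter G on n-tuples and discard coordinates until no two of them are
   G-asymptotic, hence they are uniformly apart.  The cluster property then forces
   the coordinates of any two G-typical tuples to match up, so each coordinate is
   Cauchy, converges in X, and F converges to the sum of the limits. *)

Set Implicit Arguments.
Unset Strict Implicit.
Unset Printing Implicit Defensive.

Import GRing.Theory.

Local Open Scope classical_set_scope.
Local Open Scope ring_scope.

(** * Cancellation in words over a Boolean group *)

Section BooleanWords.
Variables (X : choiceType) (G : zmodType) (f : X -> G).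
Hypothesis G2 : forall g : G, g + g = 0.

Lemma boolean_oppr (g : G) : - g = g.
Proof. by apply/esym/eqP; rewrite -subr_eq0 opprK G2. Qed.

Lemma boolean_mulrn (g : G) n : g *+ n = if odd n then g else 0.
Proof.
elim: n => [|n IH] //; rewrite mulrS IH /=.
by case: (odd n); rewrite ?G2 ?addr0.
Qed.

Lemma sum_count_even (w : seq X) :
  (forall x, ~~ odd (count_mem x w)) -> \sum_(x <- w) f x = 0.
Proof.
move=> w0; rewrite -big_undup_iterop_count big1// => x _.
rewrite -[iterop _ _ _ _]/(f x *+ _).
by rewrite boolean_mulrn (negPf (w0 x)).
Qed.

End BooleanWords.

Lemma addbb_ring (b : bool) : b + b = 0 :> bool.
Proof. by case: b. Qed.

(** Addition in [bool] is exclusive or, so parities of counts are sums in a Boolean group and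
    [sum_count_even] applies to them. *)
Lemma sum_pred (X : Type) (C : pred X) (w : seq X) :
  \sum_(x <- w) C x = odd (count C w) :> bool.
Proof.
elim: w => [|x w IH]; first by rewrite big_nil.
by rewrite big_cons IH /= oddD oddb.
Qed.

Lemma count_even (X : choiceType) (w : seq X) (C : pred X) :
  (forall x, ~~ odd (count_mem x w)) -> ~~ odd (count C w).
Proof. by move=> w0; rewrite -sum_pred (sum_count_even C addbb_ring w0). Qed.

(** * Sums of edges, one from each entourage *)

Section Edges.
Variable X : Type.
Implicit Types (E D : nat -> set (X * X)) (l : seq (X * X)).

Fixpoint edges E l : Prop :=
  if l is p :: l' then E 0 p /\ edges (fun n => E n.+1) l' else True.

Lemma sub_edges E D l : (forall n, E n `<=` D n) -> edges E l -> edges D l.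
Proof.
elim: l E D => //= p l IH E D ED [/ED Dp El]; split=> //.
by apply: IH El => n; exact: ED.
Qed.

Definition vertices l : seq X := flatten [seq [:: p.1; p.2] | p <- l].

Lemma odd_size_vertices l : odd (size (vertices l)) = false.
Proof. by elim: l => //= p l ->. Qed.

Lemma odd_count_vertices (C : pred X) l :
  all (fun p => C p.1 == C p.2) l -> odd (count C (vertices l)) = false.
Proof.
elim: l => //= p l IH /andP[/eqP -> /IH Cl].
by rewrite addnA oddD addnn odd_double.
Qed.

Lemma edges_drop E l n : edges E l -> edges (fun k => E (n + k)%N) (drop n l).
Proof.
elim: n l E => [|n IH] [|p l] E //= [_ El].
by apply: sub_edges (IH _ _ El) => k.
Qed.

(** These are the sets V(E). *)
Definition edge_sums (G : zmodType) (f : X -> G) E : set G :=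
  [set g | exists2 l, edges E l & g = \sum_(x <- vertices l) f x].

Variables (G : zmodType) (f : X -> G).
Hypothesis G2 : forall g : G, g + g = 0.

Lemma sub_edge_sums E D :
  (forall n, E n `<=` D n) -> edge_sums f E `<=` edge_sums f D.
Proof. by move=> ED _ [l El ->]; exists l => //; exact: sub_edges El. Qed.

Lemma edge_sums0 E : edge_sums f E 0.
Proof. by exists [::]; rewrite //= big_nil. Qed.

(** Interleave the two lists, the first at even places and the second at odd ones; the shorter list
    is padded with loops (x, x), which contribute zero. *)
Lemma edge_sumsD E D : (forall n x, D n (x, x)) ->
  (forall n, D n `<=` E n.*2 `&` E n.*2.+1) ->
  forall g h, edge_sums f D g -> edge_sums f D h -> edge_sums f E (g + h).
Proof.
move=> + + g h [l Dl ->] [m Dm ->] {g h}.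
elim: l m D E Dl Dm => [|p l IH] m D E /=.
  move=> _; elim: m D E => [|q m IH] D E /=.
    by move=> _ _ _; rewrite big_nil add0r; exact: edge_sums0.
  move=> [Dq Dm] Dxx DE.
  have [||r Er] := IH _ (fun n => E n.+2) Dm.
  - by move=> n x; exact: Dxx.
  - by move=> n; exact: DE.
  rewrite !big_nil !add0r /= !big_cons => ->; exists [:: (q.1, q.1), q & r].
    split; first exact: (DE 0%N _ (Dxx _ _)).1.
    by split; first exact: (DE 0%N _ Dq).2.
  by rewrite !big_cons /= [RHS]addrA G2 add0r.
move=> [Dp Dl]; case: m => [_|q m /= [Dq Dm]] Dxx DE.
  have [||r Er] := IH [::] _ (fun n => E n.+2) Dl I.
  - by move=> n x; exact: Dxx.
  - by move=> n; exact: DE.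
  rewrite !big_nil !addr0 /= !big_cons => ->; exists [:: p, (p.1, p.1) & r].
    split; first exact: (DE 0%N _ Dp).1.
    by split; first exact: (DE 0%N _ (Dxx _ _)).2.
  by rewrite !big_cons /= [f p.1 + (f p.1 + _)]addrA G2 add0r.
have [||r Er] := IH m _ (fun n => E n.+2) Dl Dm.
- by move=> n x; exact: Dxx.
- by move=> n; exact: DE.
rewrite !big_cons => e; exists [:: p, q & r].
  split; first exact: (DE 0%N _ Dp).1.
  by split; first exact: (DE 0%N _ Dq).2.
rewrite !big_cons /= -e -!addrA; congr (_ + (_ + _)).
by rewrite addrC -!addrA; congr (_ + (_ + _)); rewrite addrC.
Qed.

End Edges.

(** * Small clusters in uniform spaces *)

Section UniformClusters.
Variable X : uniformType.

Lemma entourage_sym_split3 (A : set (X * X)) : entourage A ->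
  exists2 D, entourage D & [/\ forall x y, D (x, y) -> D (y, x),
    D `<=` A & forall x y z t, D (x, y) -> D (y, z) -> D (z, t) -> A (x, t)].
Proof.
move=> entA; pose S := split_ent (split_ent A).
have entsA := entourage_split_ent entA.
have entS : entourage S := entourage_split_ent entsA.
exists (S `&` (S^-1)%relation); first exact: entourage_invI.
split=> [x y []|p [Sp _]|x y z t [xy _] [yz _] [zt _]].
- by [].
- exact: split_ent_subset entA _ (split_ent_subset entsA Sp).
- apply: (entourage_split z) => //; first exact: (entourage_split y).
  exact: split_ent_subset entsA _ zt.
Qed.

(* Choosing [D] with [D_(n+1)^3] inside [D_n], the connected component of [a] in
   the graph with one edge from each [D_n] stays close to [a]. *)
Lemma edge_clusters (A : set (X * X)) : entourage A ->
  exists2 D : nat -> set (X * X), forall n, entourage (D n) &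
  forall l a, edges D l -> exists C : pred X, [/\ C a,
    forall x, C x -> A (a, x) & all (fun p => C p.1 == C p.2) l].
Proof.
move=> entA.
have /choice[f fP] (U : set (X * X)) : exists D, entourage U -> entourage D /\
    [/\ forall x y, D (x, y) -> D (y, x), D `<=` U &
    forall x y z t, D (x, y) -> D (y, z) -> D (z, t) -> U (x, t)].
  have [/entourage_sym_split3[D entD DU]|nU] := pselect (entourage U).
    by exists D.
  by exists U.
have entf U : entourage U -> entourage (f U) by move=> /fP[].
exists (fun n => iter n f (f A)).
  by move=> n; rewrite -iterSr; elim: n.+1 => //= m /entf.
move=> l; elim: l A entA => [|p l IH] A entA a.
  move=> _; exists (xpred1 a); split=> // x /eqP ->.
  exact: entourage_refl.
have [entfA [symf subf f3]] := fP _ entA.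
move=> [/= fp El].
have {}El : edges (fun n => iter n f (f (f A))) l.
  by apply: sub_edges El => n; rewrite -[f (iter n _ _)]iterS iterSr.
have [C [Ca CA Cl]] := IH _ entfA a El.
have [Cp|nCp] := eqVneq (C p.1) (C p.2).
  by exists C; split=> [//|x /CA/subf//|]; rewrite /= Cp eqxx.
(* If only one end of the edge lies in [C], the cluster of the other end is merged with [C]; its
   points are reached from [a] in three steps: inside [C], along the edge, inside the second
   cluster. *)
have join q r : f A (q, r) -> C q -> exists K : pred X,
    [/\ K a, forall x, K x -> A (a, x), K q, K r &
        all (fun p => K p.1 == K p.2) l].
  move=> qr Cq; have [K [Kr KA Kl]] := IH _ entfA r El.
  exists (fun x => C x || K x); rewrite Ca Cq Kr orbT; split=> //.
    move=> x /orP[/CA/subf//|/KA rx]; exact: f3 (CA _ Cq) qr rx.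
  apply/allP => o ol; have /eqP-> := allP Cl _ ol.
  by have /eqP-> := allP Kl _ ol.
have {}fp : f A (p.1, p.2) by case: (p) fp.
have [Cp1|nCp1] := boolP (C p.1).
  have [K [Ka KA K1 K2 Kl]] := join _ _ fp Cp1.
  by exists K; split=> //=; rewrite K1 K2.
have [|K [Ka KA K1 K2 Kl]] := join _ _ (symf _ _ fp).
  by move: nCp; rewrite (negPf nCp1); case: (C p.2).
by exists K; split=> //=; rewrite K1 K2.
Qed.

End UniformClusters.

Lemma hausdorff_entourage (X : uniformType) (x y : X) : hausdorff_space X ->
  x != y -> exists2 A, entourage A & ~ A (x, y).
Proof.
move=> hX /eqP xy; apply: contrapT => nA; apply: xy; apply: hX => P Q xP yQ.
exists y; split; last exact: nbhs_singleton.
move/nbhsP: xP => [A entA]; apply; apply/xsectionP; apply: contrapT => nAxy.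
by apply: nA; exists A.
Qed.

(** Each pair of distinct letters is avoided by some entourage, and there are finitely many
    pairs. *)
Lemma entourage_separates_seq (X : uniformType) (w : seq X) :
  hausdorff_space X -> exists2 A, entourage A &
  forall x y, x \in w -> y \in w -> A (x, y) -> x = y.
Proof.
move=> hX; pose P (i : seq_sub w * seq_sub w) :=
  [set p : X * X | p = (val i.1, val i.2) -> val i.1 = val i.2].
exists [set p | forall i, P i p].
  apply: filter_forall => -[x y]; have [xy|] := eqVneq (val x) (val y).
    by apply: filterS (@filterT _ entourage _) => p _ _.
  move=> /(hausdorff_entourage hX)[A entA nA].
  by apply: filterS entA => p Ap pxy; case: nA; rewrite -[X in A X]pxy.
move=> x y xw yw /(_ (SeqSub xw, SeqSub yw)); exact.
Qed.

(* All functions, not only the finitely supported ones: the sets V(E) make this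
   larger group a Hausdorff topological group as well. *)
Definition boolean_functions (X : uniformType) : Type := X -> bool.

HB.instance Definition _ (X : uniformType) :=
  GRing.Zmodule.copy (boolean_functions X) (X -> bool).

(** * The Boolean topological group of functions on X *)

Section BooleanFunctions.
Variable X : uniformType.
Local Notation H := (boolean_functions X).

Definition point_mass (x : X) : H := fun y => y == x.

Lemma boolean_functions_addbb (g : H) : g + g = 0.
Proof. by apply/funext => x; exact: addbb_ring. Qed.

Lemma sum_point_mass (w : seq X) (x : X) :
  (\sum_(y <- w) point_mass y : H) x = odd (count_mem x w).
Proof.
elim: w => [|y w IH]; first by rewrite big_nil.
by rewrite big_cons /= oddD oddb -IH eq_sym.
Qed.

Definition boolean_functions_nbhs (h : H) : set_system H :=
  [set A | exists2 E : nat -> set (X * X), forall n, entourage (E n) &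
    forall v, edge_sums point_mass E v -> A (h + v)].

HB.instance Definition _ := hasNbhs.Build H boolean_functions_nbhs.

Lemma edge_sums_half (E : nat -> set (X * X)) : (forall n, entourage (E n)) ->
  exists2 D : nat -> set (X * X), forall n, entourage (D n) &
  forall g h, edge_sums point_mass D g -> edge_sums point_mass D h ->
    edge_sums point_mass E (g + h).
Proof.
move=> entE; have entD n : entourage (E n.*2 `&` E n.*2.+1) by exact: filterI.
exists (fun n => E n.*2 `&` E n.*2.+1) => //.
apply: (edge_sumsD boolean_functions_addbb) => [n x|n p]; last exact.
exact: entourage_refl (entD n).
Qed.

Lemma boolean_functions_nbhs_filter (h : H) :
  ProperFilter (boolean_functions_nbhs h).
Proof.
apply: Build_ProperFilter_ex.
  by move=> A [E entE EA]; exists (h + 0); apply/EA/edge_sums0.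
split; first by exists (fun=> setT) => // _; exact: filterT.
- move=> A B [E entE EA] [D entD DB]; exists (fun n => E n `&` D n).
    by move=> n; exact: filterI.
  move=> v Iv; split; [apply: EA|apply: DB]; apply: sub_edge_sums Iv.
    by move=> n p [].
  by move=> n p [].
- by move=> A B AB [E entE EA]; exists E => // v /EA/AB.
Qed.

Lemma boolean_functions_nbhs_singleton (h : H) (A : set H) :
  boolean_functions_nbhs h A -> A h.
Proof. by move=> [E _ EA]; rewrite -[h]addr0; apply/EA/edge_sums0. Qed.

Lemma boolean_functions_nbhs_nbhs (h : H) (A : set H) :
  boolean_functions_nbhs h A ->
  boolean_functions_nbhs h (boolean_functions_nbhs^~ A).
Proof.
move=> [E /edge_sums_half[D entD DE] EA]; exists D => // v Dv.
by exists D => // u Du; rewrite -addrA; apply/EA/DE.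
Qed.

HB.instance Definition _ := Nbhs_isNbhsTopological.Build H
  boolean_functions_nbhs_filter boolean_functions_nbhs_singleton
  boolean_functions_nbhs_nbhs.

Lemma boolean_functions_sub_continuous :
  continuous (fun g : H * H => g.1 - g.2).
Proof.
move=> [g h] A /= [E /edge_sums_half[D entD DE] EA].
exists ([set g + v | v in edge_sums point_mass D],
        [set h + v | v in edge_sums point_mass D]).
  by split; exists D => // v Dv; exists v.
move=> [_ _] [/= [v Dv <-] [u Du <-]].
rewrite [- (h + u)]opprD addrACA [- u](boolean_oppr boolean_functions_addbb).
exact/EA/DE.
Qed.

HB.instance Definition _ := PreTopologicalNmodule_isTopologicalZmodule.Build H
  boolean_functions_sub_continuous.

(** If [g] and [h] cannot be separated, [g + h] lies in every V(E), hence is the sum of a finite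
    word [l]. Where [g + h] is nonzero at [a], a cluster of [a] meeting [l] only in [a] holds an odd
    number of letters of [l], but an even number of letters of any word of edges respecting the
    cluster. *)
Lemma boolean_functions_hausdorff : hausdorff_space X -> hausdorff_space H.
Proof.
move=> hX g h gh; apply: contrapT => ghN.
have {gh}inV E : (forall n, entourage (E n)) ->
    edge_sums point_mass E (g + h).
  move=> /edge_sums_half[D entD DE].
  have [||_ [[v Dv <-] [u Du uv]]] := gh
    [set g + v | v in edge_sums point_mass D]
    [set h + v | v in edge_sums point_mass D].
  - by exists D => // v Dv; exists v.
  - by exists D => // v Dv; exists v.
  suff -> : g + h = v + u by exact: DE.
  have -> : h = g + v + u.
    by rewrite -uv -addrA boolean_functions_addbb addr0.
  by rewrite !addrA boolean_functions_addbb add0r.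
have [l _ ghl] := inV (fun=> setT) (fun=> filterT).
have [a gha] : exists a, (g + h) a.
  apply: contrapT => nex; apply: ghN.
  apply/eqP; rewrite -subr_eq0 (boolean_oppr boolean_functions_addbb).
  by apply/eqP/funext => a; rewrite -[RHS]/false; apply/negbTE/negP => gha;
    apply: nex; exists a.
have [A entA AP] := entourage_separates_seq (vertices l) hX.
have [D entD DP] := edge_clusters entA.
have [m Dm ghm] := inV D entD.
have [C [Ca CA Cm]] := DP m a Dm.
have lm x : odd (count_mem x (vertices l)) = odd (count_mem x (vertices m)).
  by rewrite -!sum_point_mass -ghl ghm.
have al : a \in vertices l.
  rewrite -has_pred1 has_count lt0n; apply/eqP => l0.
  by move: gha; rewrite ghl sum_point_mass l0.
have := @count_even _ (vertices l ++ vertices m) C.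
rewrite count_cat oddD (odd_count_vertices Cm) addbF => /(_ _)/negP; case.
  by move=> x; rewrite count_cat oddD lm addbb.
rewrite (@eq_in_count _ C (pred1 a)) -?sum_point_mass -?ghl// => x xl /=.
by apply/idP/eqP => [/CA ax|-> //]; apply/esym/AP.
Qed.

Lemma point_mass_continuous (h : H) : continuous (fun x => point_mass x + h).
Proof.
move=> x A /= [E entE EA]; move: (nbhs_entourage x (entE 0%N)).
apply: filterS => y /xsectionP xy /=.
suff -> : point_mass y + h =
    point_mass x + h + \sum_(z <- vertices [:: (x, y)]) point_mass z.
  by apply: EA; exists [:: (x, y)].
rewrite !big_cons big_nil /= addr0 [point_mass x + h]addrC -addrA.
by rewrite (addrA (point_mass x)) boolean_functions_addbb add0r addrC.
Qed.

End BooleanFunctions.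

(** * Boolean topological groups and their Cauchy filters *)

Section BooleanTopologicalGroup.
Variable B : topologicalZmodType.
Hypothesis B2 : forall g : B, g + g = 0.

Lemma boolean_addrKK (g h k : B) : g + h + (h + k) = g + k.
Proof. by rewrite -addrA [h + (h + k)]addrA B2 add0r. Qed.

Lemma nbhs0_half (V : set B) : nbhs (0 : B) V ->
  exists2 U : set B, nbhs (0 : B) U & forall g h, U g -> U h -> V (g + h).
Proof.
move=> V0; have [[P Q] [/= P0 Q0] PQ] : nbhs ((0, 0) : B * B)
    [set x | V (x.1 + x.2)].
  by apply: (@add_continuous B (0, 0)); rewrite /= addr0.
exists (P `&` Q); first exact: filterI.
by move=> g h [Pg _] [_ Qh]; exact: (PQ (g, h)).
Qed.

Lemma nbhs_translate (b : B) (V : set B) : nbhs (0 : B) V ->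
  nbhs b [set c | V (b + c)].
Proof.
move=> V0; have /= := @add_continuous B (b, b) V; rewrite /= B2 => /(_ V0).
move=> [[P Q] [/= Pb Qb] PQ]; apply: filterS Qb => c Qc.
by apply: (PQ (b, c)); split=> //=; exact: nbhs_singleton.
Qed.

Lemma nbhs0_translate (b : B) (V : set B) : nbhs b V ->
  nbhs (0 : B) [set v | V (b + v)].
Proof.
move=> Vb; have /= := @add_continuous B (b, 0) V; rewrite /= addr0 => /(_ Vb).
move=> [[P Q] [/= Pb Q0] PQ]; apply: filterS Q0 => c Qc.
by apply: (PQ (b, c)); split=> //=; exact: nbhs_singleton.
Qed.

(** Sums replace differences, the two being equal in a Boolean group. *)
Definition boolean_cauchy (F : set_system B) := forall V, nbhs (0 : B) V ->
  exists2 A, F A & forall g h, A g -> A h -> V (g + h).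

Lemma boolean_weil_completeP : weil_complete B <->
  forall F, ProperFilter F -> boolean_cauchy F -> exists b : B, F --> b.
Proof.
split=> cB F FF cF; apply: cB.
  move=> A [V V0 VA]; have [P FP PV] := cF V V0; exists (P, P) => //.
  move=> [g h] [/= Pg Ph]; apply: VA; exists (g + h); first exact: PV.
  by rewrite /= addrA B2 add0r.
move=> V V0; have [|[P Q] [/= FP FQ] PQ] := cF (left_translates V).
  by exists V.
exists (P `&` Q); first exact: filterI.
move=> g h [Pg _] [_ Qh]; have [v Vv /= ->] := PQ (g, h) (conj Pg Qh).
by rewrite addrA B2 add0r.
Qed.

End BooleanTopologicalGroup.

Lemma free_boolean_addbb (X : topologicalType) (e : X)
    (B : topologicalZmodType) (i : X -> B) :
  free_boolean_topological_group e i -> forall g : B, g + g = 0.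
Proof.
move=> freeB g.
have [-> |/(free_boolean_group freeB).2//] := eqVneq g 0.
by rewrite addr0.
Qed.

(** * Words and neighbourhoods of zero in B(X) *)

Section FreeBooleanGroup.
Variables (X : uniformType) (e : X) (B : topologicalZmodType) (i : X -> B).
Hypothesis hX : hausdorff_space X.
Hypothesis freeB : free_boolean_topological_group e i.

Let B2 := free_boolean_addbb freeB.

Lemma free_boolean_word (b : B) : exists w, b = \sum_(x <- w) i x.
Proof.
pose S : {pred B} := fun b => `[< exists w, b = \sum_(x <- w) i x >].
apply/asboolP; apply: (free_boolean_generated freeB (S := S)).
  split; first by apply/asboolP; exists [::]; rewrite big_nil.
  move=> _ _ /asboolP[v ->] /asboolP[w ->]; apply/asboolP; exists (v ++ w).
  by rewrite (boolean_oppr B2) big_cat.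
by move=> _ [x _ <-]; apply/asboolP; exists [:: x]; rewrite big_seq1.
Qed.

Lemma free_boolean_word_parity (o : bool) (b : B) :
  exists2 w, b = \sum_(x <- w) i x & odd (size w) = o.
Proof.
have [w ->] := free_boolean_word b.
have [wo|wo] := eqVneq (odd (size w)) o; first by exists w.
exists (e :: w).
  by rewrite big_cons (free_boolean_base_point freeB) add0r.
by move: wo => /=; case: odd; case: o.
Qed.

(** The universal property needs [e] sent to zero, so the point mass of [e] is added to every point
    mass; in a word of even length these extra terms cancel. *)
Lemma free_boolean_to_functions :
  exists2 fhat : {additive B -> boolean_functions X}, continuous fhat &
  forall w, ~~ odd (size w) ->
    fhat (\sum_(x <- w) i x) = \sum_(x <- w) point_mass x.
Proof.
have [|||fhat cfhat fhati] := free_boolean_universal freeB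
  (H := boolean_functions X) (f := fun x => point_mass x + point_mass e).
- split; first exact: boolean_functions_hausdorff.
  by move=> g _; exact: boolean_functions_addbb.
- exact: point_mass_continuous.
- exact: boolean_functions_addbb.
exists fhat => // w wE; rewrite raddf_sum; under eq_bigr do rewrite fhati.
rewrite big_split /= big_const_seq count_predT iter_addr_0.
by rewrite (boolean_mulrn (@boolean_functions_addbb X)) (negPf wE) addr0.
Qed.

Lemma free_boolean_count (v w : seq X) : ~~ odd (size v) -> ~~ odd (size w) ->
  \sum_(x <- v) i x = \sum_(x <- w) i x ->
  forall C : pred X, odd (count C v) = odd (count C w).
Proof.
move=> vE wE vw C; have [fhat _ fhatE] := free_boolean_to_functions.
suff : ~~ odd (count C (v ++ w)).
  by rewrite count_cat oddD; do 2!case: odd.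
apply: count_even => x; rewrite count_cat oddD -!sum_point_mass -!fhatE// vw.
by rewrite addbb.
Qed.

(** Pull V(E) back from the group of functions. An even word with image in V(E) has the same letter
    parities as some list of edges, so it has the same sum in [B]. *)
Lemma free_boolean_edge_sums_nbhs (E : nat -> set (X * X)) :
  (forall n, entourage (E n)) -> nbhs (0 : B) (edge_sums i E).
Proof.
move=> entE; have [fhat cfhat fhatE] := free_boolean_to_functions.
have : nbhs (fhat 0) (edge_sums (@point_mass X) E).
  by rewrite raddf0; exists E => // v Ev; rewrite add0r.
move=> /(cfhat 0); apply: (@filterS _ (nbhs (0 : B))) => b.
have [w -> wo] := free_boolean_word_parity false b.
rewrite /= fhatE ?wo// => -[l El wl]; exists l => //.
apply/eqP; rewrite -subr_eq0 (boolean_oppr B2) -big_cat.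
apply/eqP/(sum_count_even i B2) => x.
by rewrite count_cat oddD -!sum_point_mass wl addbb.
Qed.

Lemma free_boolean_clusters (A : set (X * X)) : entourage A ->
  exists2 D : nat -> set (X * X), forall n, entourage (D n) &
  forall w a, ~~ odd (size w) -> edge_sums i D (\sum_(x <- w) i x) ->
  exists C : pred X, [/\ C a, forall x, C x -> A (a, x) & ~~ odd (count C w)].
Proof.
move=> /edge_clusters[D entD DP]; exists D => // w a wE [l Dl wl].
have [C [Ca CA Cl]] := DP l a Dl; exists C; split=> //.
rewrite (free_boolean_count wE _ wl) ?odd_size_vertices//.
by rewrite (odd_count_vertices Cl).
Qed.

End FreeBooleanGroup.

Lemma uniq_odd_word (X : choiceType) (G : zmodType) (f : X -> G) (w : seq X) :
  (forall g : G, g + g = 0) -> exists v, [/\ uniq v,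
    odd (size v) = odd (size w) & \sum_(x <- v) f x = \sum_(x <- w) f x].
Proof.
move=> G2; pose v := [seq x <- undup w | odd (count_mem x w)].
have uv : uniq v by rewrite filter_uniq ?undup_uniq.
have vw x : ~~ odd (count_mem x (v ++ w)).
  rewrite count_cat oddD count_uniq_mem// mem_filter mem_undup oddb.
  case: (boolP (odd _)) => //= wx; rewrite addbT negbK -has_pred1 has_count.
  by case: (count _ _) wx.
exists v; split=> //.
  have := count_even xpredT vw; rewrite !count_predT size_cat oddD.
  by do 2!case: odd.
apply/eqP; rewrite -subr_eq0 (boolean_oppr G2) -big_cat /=.
by rewrite (sum_count_even f G2 vw).
Qed.

(** Pigeonhole: otherwise the complements of the finitely many [P j] would all be in [F]. *)
Lemma ultra_exists (T : Type) (I : finType) (F : set_system T)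
    (P : I -> set T) : UltraFilter F -> F [set t | exists j, P j t] ->
  exists j, F (P j).
Proof.
move=> UF FP; apply: contrapT => nP.
have nFP j : F (~` P j).
  by have [Pj|//] := in_ultra_setVsetC (P j) UF; case: nP; exists j.
have /filter_ex[t [[j Pj] /(_ j)]] : F ([set t | exists j, P j t] `&`
    [set t | forall j, (~` P j) t]).
  by apply: filterI => //; exact: (filter_forall _ nFP).
exact.
Qed.

(** * Completeness of X from that of B(X), and bounded word length *)

Section Completeness.
Variables (X : uniformType) (e : X) (B : topologicalZmodType) (i : X -> B).
Hypothesis hX : hausdorff_space X.
Hypothesis freeB : free_boolean_topological_group e i.
Hypothesis entourage_preimage : forall W, nbhs (0 : B) W ->
  entourage [set p : X * X | W (i p.1 + i p.2)].
Let B2 := free_boolean_addbb freeB.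

(** Choose V_0 = W and V_(n+1) + V_(n+1) inside V_n. If the edges in E_n have sums in V_(n+1), then
    by induction from the end of the list the edges from place k on add up into V_k. *)
Lemma edge_sums_subset (W : set B) : nbhs (0 : B) W ->
  exists2 E : nat -> set (X * X), forall n, entourage (E n) &
  edge_sums i E `<=` W.
Proof.
move=> W0; have /choice[h hP] (V : set B) : exists U : set B,
    nbhs (0 : B) V -> nbhs (0 : B) U /\ forall g h, U g -> U h -> V (g + h).
  have [/nbhs0_half[U U0 UV]|nV] := pselect (nbhs (0 : B) V); first by exists U.
  by exists V.
pose V n := iter n h W.
have V0 n : nbhs (0 : B) (V n) by elim: n => //= n /hP[].
have VD n x y : V n.+1 x -> V n.+1 y -> V n (x + y).
  by have [_] := hP _ (V0 n); exact.
exists (fun n => [set p | V n.+1 (i p.1 + i p.2)]) => [n|_ [l El ->]].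
  exact: entourage_preimage.
suff {l El}sumV l k :
    edges (fun n => [set p | V (k + n).+1 (i p.1 + i p.2)]) l ->
    V k (\sum_(x <- vertices l) i x) by exact: (sumV l 0%N).
elim: l k => [|p l IH] k; first by rewrite big_nil => _; exact: nbhs_singleton.
rewrite /= addn0 !big_cons addrA => -[Vp El]; apply: VD => //; apply: IH.
by apply: sub_edges El => n q; rewrite addSnnS.
Qed.

Lemma weil_complete_uniformly_complete :
  (forall x P, nbhs x P -> exists2 Q, nbhs (i x) Q & i @^-1` Q `<=` P) ->
  weil_complete B -> uniformly_complete X.
Proof.
move=> embi /(boolean_weil_completeP B2) cB F FF cF.
have [|b Fb] := cB (i @ F).
  move=> V /entourage_preimage/cF[[P Q] [/= FP FQ] PQ].
  exists (i @` (P `&` Q)).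
    by apply: filterS (filterI FP FQ) => x PQx; exists x.
  by move=> _ _ [x [Px _] <-] [y [_ Qy] <-]; exact: (PQ (x, y)).
(* Odd length makes [x :: w] even, as the cluster lemma requires. *)
have [w0 bw0 w0o] := free_boolean_word_parity freeB true b.
have [w [uw wo bw]] := uniq_odd_word i w0 B2.
have {bw0}bw : b = \sum_(x <- w) i x by rewrite bw.
have [A entA AP] := entourage_separates_seq w hX.
have [A1 entA1 [symA1 _ A13]] := entourage_sym_split3 entA.
have [D entD DP] := free_boolean_clusters hX freeB entA1.
have FD : F [set x | edge_sums i D (b + i x)].
  by apply: (Fb [set c | edge_sums i D (b + c)]); apply: nbhs_translate => //;
    exact: (free_boolean_edge_sums_nbhs hX freeB).
have [x Vx] := filter_ex FD.
have near_x a : a \in w -> A1 (a, x).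
  move=> aw; have [||C [Ca CA /=]] := DP (x :: w) a.
  - by rewrite /= wo w0o.
  - by rewrite big_cons addrC -bw.
  (* A cluster of [a] contains no other letter of [w], so without [x] it would hold exactly one
     letter of [x :: w]. *)
  have [Cx _|_] := boolP (C x); first exact: CA.
  suff -> : count C w = 1%N by [].
  rewrite (@eq_in_count _ C (pred1 a)) ?count_uniq_mem ?aw// => y yw /=.
  apply/idP/eqP => [Cy|-> //]; apply/esym/AP => //.
  exact: A13 (CA _ Ca) (CA _ Ca) (CA _ Cy).
(* Two letters of [w] would both be close to [x], hence equal by the choice of [A]; the empty word
   is excluded by parity. *)
have [a ab] : exists a, b = i a.
  case: w uw wo w0o {AP DP Vx} near_x bw AP => [|a [|c w]] /=.
  - by rewrite -[LHS]negbK => _ <-.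
  - by move=> _ _ _ _ ->; exists a; rewrite big_seq1.
  move=> + _ _ near_x _ AP => /andP[]; rewrite inE negb_or => /andP[/eqP + _ _].
  case; apply: AP; rewrite ?inE ?eqxx ?orbT//.
  have cx : A1 (c, x) by apply: near_x; rewrite !inE eqxx orbT.
  apply: (A13 _ x x); [exact/near_x/mem_head| |exact: symA1].
  exact: entourage_refl.
exists a => P /embi[Q]; rewrite -ab => bQ QP.
by apply: (@filterS _ F) (Fb _ bQ) => y /QP.
Qed.

(* If V_n witnessed the failure for each n, then D below, which eventually lies in
   the entourages chosen for each V_(3m), would put F near a word w of some length
   m; the first m edges and w make up 3m letters, the other edges sum into V_(3m). *)
Lemma boolean_cauchy_bounded (F : set_system B) :
  ProperFilter F -> boolean_cauchy F ->
  exists n, forall V, nbhs (0 : B) V ->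
    F [set b | exists2 w, size w = n & V (b + \sum_(x <- w) i x)].
Proof.
move=> FF cF; apply: contrapT => nF.
have /choice[V VP] n : exists V, nbhs (0 : B) V /\
    ~ F [set b | exists2 w, size w = n & V (b + \sum_(x <- w) i x)].
  apply: contrapT => nV; apply: nF; exists n => V V0; apply: contrapT => nFV.
  by apply: nV; exists V.
have /choice[E EP] m : exists E : nat -> set (X * X),
    (forall n, entourage (E n)) /\ edge_sums i E `<=` V (3 * m)%N.
  by have [E] := edge_sums_subset (VP (3 * m)%N).1; exists E.
pose D k := [set p | forall m : 'I_k.+1, E m (k - m)%N p].
have entD k : entourage (D k).
  by apply: filter_forall => m; exact: (EP m).1.
have [A FA AD] := cF _ (free_boolean_edge_sums_nbhs hX freeB entD).
have [b Ab] := filter_ex FA; have [w bw] := free_boolean_word freeB b.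
apply: (VP (3 * size w)%N).2; apply: filterS FA => c Ac.
have [l Dl bcl] := AD _ _ Ab Ac; pose m := size w.
pose v := w ++ vertices (take m l).
have sv : (size v <= 3 * m)%N.
  rewrite size_cat mulSn leq_add2l; elim: m l {Dl bcl v} => [|k IH] [|p l] //=.
  by rewrite mulnS add2n !ltnS IH.
(* The letter [e] has value zero, so padding with it only adjusts the length. *)
exists (v ++ nseq (3 * m - size v)%N e).
  by rewrite size_cat size_nseq subnKC.
apply: (EP m).2; exists (drop m l).
  apply: sub_edges (edges_drop m Dl) => k p /= Dp.
  by have := Dp (inord m); rewrite inordK ?addKn// ltnS leq_addr.
rewrite 2!big_cat /= -bw [\sum_(x <- nseq _ _) _]big1_seq ?addr0; last first.
  by move=> x /andP[_ /nseqP[-> _]]; exact: free_boolean_base_point freeB.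
rewrite addrA [c + b]addrC bcl -{1}(cat_take_drop m l) /vertices map_cat.
by rewrite flatten_cat big_cat /= -addrA addrC -addrA B2 addr0.
Qed.

End Completeness.

(** * Convergence of Cauchy filters on B(X) *)

Section Convergence.
Variables (X : uniformType) (e : X) (B : topologicalZmodType) (i : X -> B).
Hypothesis hX : hausdorff_space X.
Hypothesis freeB : free_boolean_topological_group e i.
Hypothesis entourage_preimage : forall W, nbhs (0 : B) W ->
  entourage [set p : X * X | W (i p.1 + i p.2)].
Let B2 := free_boolean_addbb freeB.

(* Along [G], the sum of the letters with index in [J] is asymptotic to [F]. *)
Definition words_near n (F : set_system B) (G : set_system ('I_n -> X))
    (J : {set 'I_n}) := forall A V, F A -> nbhs (0 : B) V ->
  G [set t | exists2 b, A b & V (b + \sum_(j in J) i (t j))].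

(** By hypothesis the sets of tuples whose sum is [V]-close to [A] generate a proper filter, which
    extends to an ultrafilter. *)
Lemma ultra_words_near n (F : set_system B) : ProperFilter F ->
  (forall V, nbhs (0 : B) V ->
    F [set b | exists2 w, size w = n & V (b + \sum_(x <- w) i x)]) ->
  exists2 G : set_system ('I_n -> X), UltraFilter G &
    words_near F G [set: 'I_n]%SET.
Proof.
move=> FF Fn; pose S (AV : set B * set B) : set ('I_n -> X) :=
  [set t | exists2 b, AV.1 b & AV.2 (b + \sum_(j in [set: 'I_n]%SET) i (t j))].
pose D (AV : set B * set B) := F AV.1 /\ nbhs (0 : B) AV.2.
have [|G [GU FG]] := @ultraFilterLemma _ (filter_from D S).
  apply: filter_from_proper.
    apply: filter_from_filter.
      by exists (setT, setT); split; exact: filterT.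
    move=> [A V] [A' V'] [/= FA V0] [/= FA' V0'].
    exists (A `&` A', V `&` V'); first by split; exact: filterI.
    by move=> t [b [Ab A'b] [Vb V'b]]; split; exists b.
  move=> [A V] [/= FA V0].
  have [b [Ab [w wn Vb]]] := filter_ex (filterI FA (Fn V V0)).
  exists (fun j => nth e w j), b => //=; move: Vb.
  rewrite (big_nth e) wn big_mkord; congr (V (b + _)).
  by apply: eq_bigl => j; rewrite inE.
exists G => // A V FA V0; by apply: FG; exists (A, V).
Qed.

(** If coordinates [j] and [k] were asymptotic along [G], their two letters would nearly cancel and
    both could be dropped from [J]. *)
Lemma words_near_minimal n (F : set_system B) (G : set_system ('I_n -> X))
    (J : {set 'I_n}) : Filter G ->
  words_near F G J ->
  (forall K : {set 'I_n}, words_near F G K -> K \subset J -> K = J) ->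
  forall j k, j \in J -> k \in J -> j != k ->
  exists2 E, entourage E & ~ G [set t | E (t j, t k)].
Proof.
move=> GF GJ minJ j k jJ kJ jk; apply: contrapT => nE.
suff /minJ : words_near F G ((J :\ j) :\ k).
  move=> /(_ (fintype.subset_trans (subD1set _ _) (subD1set _ _))) eJ.
  by move: jJ; rewrite -eJ !inE eqxx andbF.
move=> A V FA V0; have [U U0 UV] := nbhs0_half V0.
have GU : G [set t | U (i (t j) + i (t k))].
  apply: contrapT => nU; apply: nE.
  by exists [set p | U (i p.1 + i p.2)]; first exact: entourage_preimage.
apply: filterS (filterI (GJ A U FA U0) GU) => t [[b Ab Ub] Ujk].
exists b => //; have := UV _ _ Ub Ujk.
rewrite (big_setD1 j) //= (big_setD1 k) /=; last by rewrite !inE eq_sym jk.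
by rewrite [i (t j) + (_ + _)]addrA [_ + _ + \sum_(_ in _) _]addrC [b + _]addrA
  -[_ + _ + (_ + _)]addrA B2 addr0.
Qed.

(** Fix a typical tuple [t]. For typical [s], a cluster of [s j] contains no other letter of [s],
    because [E0] keeps coordinates apart; the joint word of [s] and [t] being nearly zero, the
    cluster contains some [t k]. By pigeonhole one [k] serves for [G]-almost all [s]. *)
Lemma words_near_cauchy n (F : set_system B) (G : set_system ('I_n -> X))
    (J : {set 'I_n}) : UltraFilter G -> boolean_cauchy F ->
  words_near F G J ->
  (forall K : {set 'I_n}, words_near F G K -> K \subset J -> K = J) ->
  forall j A, j \in J -> entourage A -> exists y, G [set t | A (t j, y)].
Proof.
move=> GU cF GJ minJ j A jJ entA.
have PG : ProperFilter G by exact: ultra_proper.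
have sepJ := words_near_minimal _ GJ minJ.
have /choice[E EP] (p : 'I_n * 'I_n) : exists E : set (X * X), entourage E /\
    (p.1 \in J -> p.2 \in J -> p.1 != p.2 -> G [set t | ~ E (t p.1, t p.2)]).
  case: (pselect [/\ p.1 \in J, p.2 \in J & p.1 != p.2]) => [[p1 p2 p12]|np].
    have [E entE nE] := sepJ _ _ _ p1 p2 p12; exists E; split=> // _ _ _.
    by have [|] := in_ultra_setVsetC [set t | E (t p.1, t p.2)] GU.
  by exists setT; split=> [|p1 p2 p12]; [exact: filterT|case: np].
pose E0 := A `&` [set q | forall p, E p q].
have entE0 : entourage E0.
  by apply: filterI => //; apply: filter_forall => p; exact: (EP p).1.
have GE0 : G [set t | forall p : 'I_n * 'I_n,
    p.1 \in J -> p.2 \in J -> E0 (t p.1, t p.2) -> p.1 = p.2].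
  apply: filter_forall => p.
  case: (pselect [/\ p.1 \in J, p.2 \in J & p.1 != p.2]) => [[p1 p2 p12]|np].
    by apply: filterS ((EP p).2 p1 p2 p12) => t nEt _ _ [_ /(_ p)/nEt].
  apply: filterS (@filterT _ G _) => t _ p1 p2 _; apply: contrapT => p12.
  by apply: np; split=> //; exact/eqP.
have [D entD DP] := free_boolean_clusters hX freeB entE0.
have [U1 U10 U1D] := nbhs0_half (free_boolean_edge_sums_nbhs hX freeB entD).
have [U2 U20 U21] := nbhs0_half U10.
have [P FP PU1] := cF _ U10.
have GQ := @filterI _ G PG _ _ (GJ P U2 FP U20) GE0.
have [t [[b Pb Ub] _]] := filter_ex GQ.
suff GA : G [set s | exists k, A (s j, t k)].
  by have [k Gk] := ultra_exists GU GA; exists (t k).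
apply: filterS GQ => s [[c Pc Uc] sE0].
have [||C [Cj CE0]] :=
  DP ([seq s k | k <- enum J] ++ [seq t k | k <- enum J]) (s j).
- by rewrite size_cat !size_map oddD addbb.
- rewrite big_cat !big_map /= !big_enum.
  have cancel (g h : B) : c + b + (c + g + (b + h)) = g + h.
    by rewrite [c + g + _]addrACA [LHS]addrA B2 add0r.
  by rewrite -(cancel (\sum_(k in J) _)); apply: U1D; [exact: PU1|exact: U21].
rewrite count_cat oddD !count_map.
have -> : count (preim s C) (enum J) = 1%N.
  rewrite (@eq_in_count _ _ (pred1 j)).
    by rewrite count_uniq_mem ?enum_uniq// mem_enum jJ.
  move=> k; rewrite mem_enum => kJ /=; apply/idP/eqP => [/CE0 Ejk|-> //].
  exact/esym/(sE0 (j, k)).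
rewrite addTb negbK => Ct; have /hasP[k kJ Ck] : has (preim t C) (enum J).
  by rewrite has_count; case: count Ct.
by exists k; have [] := CE0 _ Ck.
Qed.

Lemma sum_words_cvg (T : Type) (I : eqType) (G : set_system T) (f : I -> T -> X)
    (x : I -> X) (s : seq I) (V : set B) : Filter G ->
  (forall j A, j \in s -> entourage A -> G [set t | A (f j t, x j)]) ->
  nbhs (0 : B) V -> G [set t | V (\sum_(j <- s) (i (f j t) + i (x j)))].
Proof.
move=> GF; elim: s V => [|j s IH] V fx V0.
  by apply: filterS filterT => t _; rewrite /= big_nil; exact: nbhs_singleton.
have [U U0 UV] := nbhs0_half V0.
have Us : G [set t | U (\sum_(k <- s) (i (f k t) + i (x k)))].
  by apply: IH => // k A ks; apply: fx; rewrite inE ks orbT.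
have Uj := fx _ _ (mem_head j s) (entourage_preimage U0).
apply: filterS (filterI Uj Us) => t /= [{}Uj {}Us].
by rewrite big_cons; exact: UV.
Qed.

Lemma uniformly_complete_weil_complete :
  uniformly_complete X -> weil_complete B.
Proof.
move=> cX; apply/(boolean_weil_completeP B2) => F FF cF.
have [n Fn] := boolean_cauchy_bounded hX freeB entourage_preimage FF cF.
have [G GU GT] := ultra_words_near FF Fn.
have [J /minsetP[/asboolP GJ minJ] _] :=
  @minset_exists _ (fun J => `[< words_near F G J >]) [set: 'I_n]%SET
    (asboolT GT).
have {}minJ (K : {set 'I_n}) : words_near F G K -> K \subset J -> K = J.
  by move=> /asboolT/minJ.
have /choice[x xP] (j : 'I_n) : exists x : X, j \in J ->
    forall A, entourage A -> G [set t | A (t j, x)].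
  have [jJ|] := boolP (j \in J); last by exists e.
  have [|x Gx] := cX ((fun t : 'I_n -> X => t j) @ G).
    move=> A entA; have [D entD [symD _ D3]] := entourage_sym_split3 entA.
    have [y Gy] := words_near_cauchy GU cF GJ minJ jJ entD.
    exists ([set x | D (x, y)], [set x | D (x, y)]) => // -[p q] [/= Dp Dq].
    exact: D3 Dp (symD _ _ Dq) (entourage_refl _ entD).
  exists x => _ A entA.
  move: (Gx _ (nbhs_entourage x (entourage_inv entA))).
  by apply: (@filterS _ G) => t /xsectionP.
exists (\sum_(j in J) i (x j)) => P /nbhs0_translate P0.
have [U1 U10 U1P] := nbhs0_half P0; have [U2 U20 U21] := nbhs0_half U10.
have [A FA AU] := cF _ U10.
have GS : G [set t | U2 (\sum_(j <- enum J) (i (t j) + i (x j)))].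
  apply: (@sum_words_cvg _ _ G (fun j t => t j)) => // j C.
  by rewrite mem_enum => jJ; exact: xP.
have [t [[b Ab Ub] Us]] := filter_ex (filterI (GJ A U2 FA U20) GS).
apply: filterS FA => c Ac.
(* Here [b], the letters of [t] and the limits cancel in pairs, leaving [c]. *)
have := U1P _ _ (AU _ _ Ac Ab) (U21 _ _ Ub Us).
congr P; rewrite big_enum big_split /=.
by rewrite !(boolean_addrKK B2) addrCA B2 addr0.
Qed.

End Convergence.

Lemma embedding_nbhsP (X Y : topologicalType) (i : X -> Y) :
  topological_embedding i -> forall x P,
  nbhs x P <-> exists2 Q, nbhs (i x) Q & i @^-1` Q `<=` P.
Proof.
move=> [_ iE] x P; split=> [|[Q]].
  rewrite nbhsE => -[U [/iE[V oV <-] Vx] VP].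
  by exists V => //; exact: open_nbhs_nbhs.
rewrite nbhsE => -[V [oV Vx] VQ] QP; rewrite nbhsE.
exists (i @^-1` V); last by move=> y /VQ/QP.
by split=> //; apply/iE; exists V.
Qed.

(** * Refining a uniformity by the trace of the group uniformity *)

Section RefinedUniformity.
Variables (X : topologicalType) (B : topologicalZmodType) (i : X -> B).
Hypothesis B2 : forall g : B, g + g = 0.
Hypothesis embi : topological_embedding i.
Variable U : set_system (X * X).
Hypothesis U_filter : Filter U.
Hypothesis U_diagonal : forall A, U A -> (diagonal `<=` A)%classic.
Hypothesis U_inv : forall A, U A -> U (A^-1)%relation.
Hypothesis U_split :
  forall A, U A -> exists2 D, U D & (D \; D `<=` A)%relation.
Hypothesis U_nbhs : forall A x, U A -> nbhs x (xsection A x).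

(** [U] may be coarser than the topology of [X]: the trace of the uniformity of [B] makes the join
    compatible. This serves both a trivial [U] and a complete one. *)
Definition refined_entourage : set_system (X * X) :=
  filter_from [set EW : set (X * X) * set B | U EW.1 /\ nbhs (0 : B) EW.2]
    (fun EW => EW.1 `&` [set p | EW.2 (i p.1 + i p.2)]).

Lemma refined_entourage_filter : Filter refined_entourage.
Proof.
apply: filter_from_filter.
  by exists (setT, setT); split; exact: filterT.
move=> [E W] [E' W'] [/= UE W0] [/= UE' W'0].
exists (E `&` E', W `&` W'); first by split; exact: filterI.
by move=> p [[Ep E'p] [Wp W'p]].
Qed.

Lemma refined_entourage_diagonal A :
  refined_entourage A -> (diagonal `<=` A)%classic.
Proof.
move=> [[E W] [/= UE W0] EWA] [x y] xy; apply: EWA.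
split; first exact: U_diagonal xy.
by rewrite /= -[in i y](xy : x = y) B2; exact: nbhs_singleton.
Qed.

Lemma refined_entourage_inv A :
  refined_entourage A -> refined_entourage (A^-1)%relation.
Proof.
move=> [[E W] [/= UE W0] EWA]; exists ((E^-1)%relation, W).
  by split=> //; exact: U_inv.
by move=> [x y] [/= Exy Wxy]; apply: EWA; split=> //=; rewrite addrC.
Qed.

Lemma refined_entourage_split A : refined_entourage A ->
  exists2 D, refined_entourage D & (D \; D `<=` A)%relation.
Proof.
move=> [[E W] [/= /U_split[D UD DE] /nbhs0_half[V V0 VW]] EWA].
exists (D `&` [set p | V (i p.1 + i p.2)]); first by exists (D, V).
move=> [x z] [y [Dxy Vxy] [Dyz Vyz]]; apply: EWA; split=> /=.
  by apply: DE; exists y.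
by rewrite -(boolean_addrKK B2 _ (i y)); exact: VW.
Qed.

Lemma refined_entourage_nbhsE : nbhs = nbhs_ refined_entourage.
Proof.
apply/funext => x; apply/seteqP; split=> P.
  move=> /(embedding_nbhsP embi)[Q /nbhs0_translate Q0 QP].
  exists [set p | Q (i x + (i p.1 + i p.2))].
    exists (setT, [set v | Q (i x + v)]); first by split=> //; exact: filterT.
    by move=> p [].
  by move=> y /xsectionP /=; rewrite addrA B2 add0r => /QP.
move=> [A [[E W] [/= UE W0] EWA] AP].
have Wx : nbhs x [set y | W (i x + i y)].
  by apply/(embedding_nbhsP embi); exists [set c | W (i x + c)];
    first exact: nbhs_translate.
apply: filterS (filterI (U_nbhs x UE) Wx) => y [/xsectionP Exy Wxy].
exact/AP/xsectionP/EWA.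
Qed.

Definition refined_uniformity : Nbhs_isUniform_mixin X :=
  Nbhs_isUniform_mixin.Build X refined_entourage_filter
    refined_entourage_diagonal refined_entourage_inv refined_entourage_split
    refined_entourage_nbhsE.

Lemma refined_uniformity_finer A :
  U A -> @entourage (uniformity_space refined_uniformity) A.
Proof.
move=> UA; exists (A, setT); first by split=> //; exact: filterT.
by move=> p [].
Qed.

Lemma refined_uniformity_preimage W : nbhs (0 : B) W ->
  @entourage (uniformity_space refined_uniformity)
    [set p | W (i p.1 + i p.2)].
Proof.
move=> W0; exists (setT, W); first by split=> //; exact: filterT.
by move=> p [].
Qed.

End RefinedUniformity.

(* [X] and the topological space underlying [uniformity_space u] have convertible
   fields without being convertible records. *)
Lemma free_boolean_uniformity_space (X : topologicalType) (e : X)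
    (B : topologicalZmodType) (i : X -> B) (u : Nbhs_isUniform_mixin X) :
  free_boolean_topological_group e i ->
  @free_boolean_topological_group (uniformity_space u) e B i.
Proof. by case=> Bg emb base gen univ; split. Qed.

(** * The two implications for topological spaces *)

Section Equivalence.
Variables (X : topologicalType) (e : X) (B : topologicalZmodType) (i : X -> B).
Hypothesis hX : hausdorff_space X.
Hypothesis freeB : free_boolean_topological_group e i.
Let B2 := free_boolean_addbb freeB.
Let embi := free_boolean_embedding freeB.

Lemma free_boolean_dieudonne_complete :
  weil_complete B -> dieudonne_complete X.
Proof.
(* With the trivial [U], the refinement is just the trace of the uniformity of [B]. *)
move=> cB; pose U : set_system (X * X) := [set setT].
have U_filter : Filter U.
  by split=> // [_ _ -> ->|P Q PQ /= PT]; [rewrite setIT|];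
    apply/seteqP; split=> // p _; apply: PQ; rewrite PT.
have U_diagonal A : U A -> (diagonal `<=` A)%classic by move=> ->.
have U_inv A : U A -> U (A^-1)%relation by move=> ->.
have U_split A : U A -> exists2 D, U D & (D \; D `<=` A)%relation.
  by move=> ->; exists setT.
have U_nbhs A x : U A -> nbhs x (xsection A x).
  by move=> ->; apply: filterS filterT => y _; exact/xsectionP.
pose u := refined_uniformity B2 embi U_filter U_diagonal U_inv U_split U_nbhs.
exists u.
apply: (weil_complete_uniformly_complete (X := uniformity_space u) (i := i) hX
  (free_boolean_uniformity_space u freeB)) => //.
- exact: refined_uniformity_preimage.
- by move=> x P /(embedding_nbhsP embi).
Qed.

Lemma free_boolean_weil_complete : dieudonne_complete X -> weil_complete B.
Proof.
move=> [u cu]; pose U : set_system (X * X) := @entourage (uniformity_space u).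
pose v := refined_uniformity B2 embi (U := U)
  (@entourage_filter' (uniformity_space u))
  (@entourage_diagonal_subproof (uniformity_space u))
  (@entourage_inv (uniformity_space u))
  (@entourage_split_ex (uniformity_space u))
  (fun A x => @nbhs_entourage (uniformity_space u) x A).
apply: (uniformly_complete_weil_complete (X := uniformity_space v) (i := i) hX
  (free_boolean_uniformity_space v freeB)).
  exact: refined_uniformity_preimage.
(* A filter that is Cauchy for the finer [v] is Cauchy for [u], and both uniformities induce the
   same topology. *)
move=> F FF cF; apply: cu => A UA; apply: cF.
exact: refined_uniformity_finer.
Qed.

End Equivalence.

Theorem theorem2p1 (X : topologicalType) (e : X)
    (B : topologicalZmodType) (i : X -> B) :
  tychonoff_space X -> free_boolean_topological_group e i ->
  (weil_complete B <-> dieudonne_complete X).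
Proof.
move=> [hX _] freeB; split; first exact: free_boolean_dieudonne_complete freeB.
exact: free_boolean_weil_complete freeB.
Qed.
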